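(* Let $(A,H,D)$, with representation $\pi$ and anti-linear map $J:H\to H$, be a $\nu$-twisted real spectral triple with signs $\epsilon,\epsilon'$. Let $\alpha\in\Omega^1_D$ be a one-form such that $\alpha+\epsilon'\,\nu J\alpha J^{-1}\nu$ is selfadjoint, and let $$D_\alpha := D+\alpha+\epsilon'\,\nu J\alpha J^{-1}\nu$$ be the corresponding twisted fluctuation of $D$. Then: (1) $(A,H,D_\alpha)$, with the same $\pi$, $\nu$ and $J$, is also a $\nu$-twisted real spectral triple. (2) If $(A,H,D)$ is even with grading $\gamma$, then $(A,H,D_\alpha)$ is even with the same grading $\gamma$. (3) The composition of twisted fluctuations is a twisted fluctuation: if $\beta\in\Omega^1_{D_\alpha}$ is such that $\beta+\epsilon'\,\nu J\beta J^{-1}\nu$ is selfadjoint, then $(D_\alpha)_\beta = D_\alpha+\beta+\epsilon'\,\nu J\beta J^{-1}\nu$ is a twisted fluctuation of $D$, i.e. equals $D_\delta$ for some $\delta\in\Omega^1_D$ with $\delta+\epsilon'\,\nu J\delta J^{-1}\nu$ selfadjoint.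
   Context: **Spectral triple.** $A$ is a complex $*$-algebra, $H$ a Hilbert space, $\pi$ a $*$-representation of $A$ on $H$ by bounded operators, and $D$ an (essentially) selfadjoint operator on a dense domain $H_0\subseteq H$ with compact resolvent such that $[D,\pi(a)]$ is bounded for every $a\in A$. **Twist.** $\nu$ is an (essentially) selfadjoint invertible operator on $H$ whose domain contains $H_0$, and $\bar\nu(\phi):=\nu\circ\phi\circ\nu^{-1}$. It is required that $\bar\nu$ maps $\pi(A)$ into bounded operators; more precisely, for all $a\in A$, $\nu\pi(a)\nu^{-1}$ preserves $H_0$ and is bounded on $H_0$, so it extends to an element of $B(H)$. It is also required that there is an algebra automorphism $\hat\nu:A\to A$ with $\pi\circ\hat\nu=\bar\nu\circ\pi$. **$\nu$-twisted real spectral triple.** The spectral triple $(A,H,D)$ is a $\nu$-twisted real spectral triple (admits a $\nu$-twisted real structure $J$) if $J:H\to H$ is an antiunitary (anti-linear) map such that, for some signs $\epsilon,\epsilon'\in\{+,-\}$ and all $a,b\in A$: - $J^2=\epsilon\,\mathrm{id}$; - $[\pi(a),J\pi(b)J^{-1}]=0$ (order-zero condition); - $[D,\pi(a)]\,J\bar\nu^2(\pi(b))J^{-1}=J\pi(b)J^{-1}[D,\pi(a)]$ (twisted order-one condition); - $DJ\nu=\epsilon'\,\nu JD$ (twisted $\epsilon'$-condition); - $\nu J\nu=J$ (twisted regularity). The last two conditions are understood as identities of operators $H_0\to H_0$. **Even case.** The triple is even with grading $\gamma$ if $\gamma:H\to H$ is a selfadjoint operator with $\gamma^2=\mathrm{id}$,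 $[\gamma,\pi(a)]=0$ for all $a\in A$, $\gamma D=-D\gamma$, $\nu^2\gamma=\gamma\nu^2$, and $\gamma J=\epsilon''J\gamma$ for some sign $\epsilon''\in\{+,-\}$. **One-forms.** For an (essentially) selfadjoint operator $D$ on the dense domain $H_0\subseteq H$ with compact resolvent and with $[D,\pi(a)]$ bounded for every $a\in A$, $$\Omega^1_D:=\Big\{\sum_i\pi(a_i)[D,\pi(b_i)] : a_i,b_i\in A\Big\}\quad\text{(finite sums)}.$$
   Formalization: Here ''selfadjoint'' for α+ε'νJαJ⁻¹ν (likewise for β and δ) means that it extends from H₀ to a bounded selfadjoint operator on H; this is needed because for unbounded ν an unbounded selfadjoint fluctuation can destroy the compact resolvent. *)

(* Defs.v *)
From HB Require Import structures.
From mathcomp Require Import all_boot all_order all_algebra.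
From mathcomp Require Import complex.
From mathcomp Require Import all_classical all_reals all_analysis.

Set Implicit Arguments.
Unset Strict Implicit.
Unset Printing Implicit Defensive.

Import Order.TTheory GRing.Theory Num.Theory Num.Def.
Import numFieldNormedType.Exports.

Local Open Scope classical_set_scope.
Local Open Scope ring_scope.
Local Open Scope complex_scope.

(* No unit is assumed; a unital *-algebra is a particular case. *)
HB.mixin Record Lmodule_isStarAlgebra (C : numClosedFieldType) A
    of GRing.Lmodule C A := {
  amul : A -> A -> A;
  star : A -> A;
  amulA : associative amul;
  amul_linearl : forall b, linear (amul^~ b);
  amul_linearr : forall a, linear (amul a);
  starK : involutive star;
  star_antilinear : forall (c : C) a b, star (c *: a + b) = conjC c *: star a + star b;
  star_amul : forall a b, star (amul a b) = amul (star b) (star a)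
}.

#[short(type="starAlgType")]
HB.structure Definition StarAlgebra (C : numClosedFieldType) :=
  {A of GRing.Lmodule C A & Lmodule_isStarAlgebra C A}.

(* The inner product is linear in its first argument. *)
HB.mixin Record CompleteNormedModule_isHilbert (R : realType) H
    of CompleteNormedModule R[i] H := {
  inner : {dot H for conjC};
  inner_norm : forall x : H, inner x x = `|x| ^+ 2
}.

#[short(type="hilbertType")]
HB.structure Definition Hilbert (R : realType) :=
  {H of CompleteNormedModule R[i] H & CompleteNormedModule_isHilbert R H}.

(* An operator with domain a subspace V of H is given by V together with a
   function T : H -> H; the values of T outside V are irrelevant. *)
Section Operators.
Context {R : realType} {H : hilbertType R}.
Implicit Types (V : set H) (T S : H -> H) (G : set (H * H)).

Local Notation "''[' x , y ]" := (inner x y) : ring_scope.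

Definition subspace V :=
  V 0 /\ forall (c : R[i]) x y, V x -> V y -> V (c *: x + y).

Definition linear_on V T :=
  forall (c : R[i]) x y, V x -> V y -> T (c *: x + y) = c *: T x + T y.

Definition bounded_on V T :=
  exists M : R[i], forall x, V x -> `|T x| <= M * `|x|.

Definition bounded_operator T := linear T /\ bounded_on setT T.

Definition bounded_selfadjoint T :=
  bounded_operator T /\ forall x y, '[T x, y] = '[x, T y].

Definition compact_operator T :=
  bounded_operator T /\ precompact (T @` [set x | `|x| <= 1]).

Definition graph V T : set (H * H) := [set p | V p.1 /\ p.2 = T p.1].

Definition adjoint_graph G : set (H * H) :=
  [set p | forall q, G q -> '[q.2, p.1] = '[q.1, p.2]].

(* The closure of (V, T) is selfadjoint; in particular this holds when (V, T)
   itself is selfadjoint, since a selfadjoint operator is closed. *)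
Definition essentially_selfadjoint V T :=
  adjoint_graph (closure (graph V T)) = closure (graph V T).

(* S = (G - z)^-1, for G the graph of a closed operator. *)
Definition is_resolvent G (z : R[i]) S :=
  (forall y, G (S y, y + z *: S y)) /\
  (forall x y, G (x, y) -> S (y - z *: x) = x).

Definition compact_resolvent V T :=
  exists z S, is_resolvent (closure (graph V T)) z S /\ compact_operator S.

Definition opcomm S T : H -> H := fun x => S (T x) - T (S x).

End Operators.

Definition star_representation (R : realType) (A : starAlgType R[i])
    (H : hilbertType R) (pi : A -> H -> H) :=
  [/\ forall a, bounded_operator (pi a),
      forall (c : R[i]) a b x, pi (c *: a + b) x = c *: pi a x + pi b x,
      forall a b x, pi (amul a b) x = pi a (pi b x) &
      forall a x y, inner (pi (star a) x) y = inner x (pi a y)].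

Section TwistedTriples.
Context {R : realType} {A : starAlgType R[i]} {H : hilbertType R}.
Variables (pi : A -> H -> H) (H0 : set H).

(* That [D, pi a] makes sense on H0 includes that pi a preserves H0. *)
Definition spectral_triple (D : H -> H) :=
  [/\ star_representation pi,
      subspace H0 /\ dense H0,
      linear_on H0 D /\ essentially_selfadjoint H0 D,
      compact_resolvent H0 D &
      forall a, (forall x, H0 x -> H0 (pi a x)) /\ bounded_on H0 (opcomm D (pi a))].

Variables (V : set H) (nu : H -> H).

(* V is the domain of nu; pinv V nu is nu^-1, with domain nu @` V. *)
Definition nubar (phi : H -> H) : H -> H := nu \o phi \o pinv V nu.

Definition algebra_automorphism (f : A -> A) :=
  [/\ bijective f, linear f & forall a b, f (amul a b) = amul (f a) (f b)].

(* nu is invertible as an operator V -> nu @` V; nu and its inverse may be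
   unbounded, so H0 is required to lie in the domain of nu \o pi a \o nu^-1. *)
Definition twist :=
  [/\ subspace V /\ H0 `<=` V,
      linear_on V nu /\ essentially_selfadjoint V nu,
      forall x y, V x -> V y -> nu x = nu y -> x = y,
      forall a,
        [/\ forall x, H0 x -> (nu @` V) x /\ V (pi a (pinv V nu x)),
            forall x, H0 x -> H0 (nubar (pi a) x) &
            bounded_on H0 (nubar (pi a))] &
      exists nuhat, algebra_automorphism nuhat /\
        forall a x, H0 x -> pi (nuhat a) x = nubar (pi a) x].

Variable J : H -> H.

Definition antiunitary :=
  [/\ forall (c : R[i]) x y, J (c *: x + y) = conjC c *: J x + J y,
      bijective J &
      forall x y, inner (J x) (J y) = inner y x].

Local Notation Jinv := (pinv setT J).

(* A sign is represented by b : bool, standing for (-1) ^+ b.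
   Identities between bounded operators involving D or nu are stated on the
   dense subspace H0.  The identities D J nu = +/- nu J D and nu J nu = J are
   between operators H0 -> H0, which amounts to D, J and nu preserving H0. *)
Definition twisted_real_spectral_triple (D : H -> H) (eps eps' : bool) :=
  [/\ spectral_triple D /\ twist,
      antiunitary /\ (forall x, J (J x) = (-1) ^+ eps *: x),
      [/\ forall x, H0 x -> H0 (D x),
          forall x, H0 x -> H0 (J x) &
          forall x, H0 x -> H0 (nu x)],
      (forall a b x, opcomm (pi a) (J \o pi b \o Jinv) x = 0) /\
      (forall a b x, H0 x ->
         opcomm D (pi a) (J (nubar (nubar (pi b)) (Jinv x))) =
         J (pi b (Jinv (opcomm D (pi a) x)))) &
      (forall x, H0 x -> D (J (nu x)) = (-1) ^+ eps' *: nu (J (D x))) /\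
      (forall x, H0 x -> nu (J (nu x)) = J x)].

Definition even_with_grading (D gamma : H -> H) (eps'' : bool) :=
  [/\ bounded_selfadjoint gamma /\ (forall x, gamma (gamma x) = x),
      forall a x, opcomm gamma (pi a) x = 0,
      (forall x, H0 x -> H0 (gamma x)) /\
      (forall x, H0 x -> gamma (D x) = - D (gamma x)),
      forall x, H0 x -> nu (nu (gamma x)) = gamma (nu (nu x)) &
      forall x, gamma (J x) = (-1) ^+ eps'' *: J (gamma x)].

(* An element of Omega^1_D is a bounded operator on H, determined by its values
   on H0, where [D, pi b] is given by its defining formula. *)
Definition one_form (D alpha : H -> H) :=
  bounded_operator alpha /\
  exists s : seq (A * A), forall x, H0 x ->
    alpha x = \sum_(ab <- s) pi ab.1 (opcomm D (pi ab.2) x).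

Definition fluctuation (eps' : bool) (alpha : H -> H) : H -> H :=
  fun x => alpha x + (-1) ^+ eps' *: nu (J (alpha (Jinv (nu x)))).

(* The operator fluctuation eps' alpha, given on H0, defines a selfadjoint
   element of B(H); boundedness is not automatic when nu is unbounded. *)
Definition selfadjoint_fluctuation (eps' : bool) (alpha : H -> H) :=
  exists S, bounded_selfadjoint S /\
    forall x, H0 x -> S x = fluctuation eps' alpha x.

Definition fluctuated (D : H -> H) (eps' : bool) (alpha : H -> H) : H -> H :=
  fun x => D x + fluctuation eps' alpha x.

End TwistedTriples.

(* Main.v *)
Require Import Defs.
From mathcomp Require Import all_boot all_order all_algebra.
From mathcomp Require Import complex ring lra.
From mathcomp Require Import all_classical all_reals all_analysis.

(* On H0 the fluctuated operator is D plus a bounded selfadjoint operator B, so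
   its closure is selfadjoint, hence has a resolvent at i; the second resolvent
   identity writes it as the compact resolvent of D times a bounded operator.
   By the twisted order-one condition nu J alpha J^-1 nu commutes with pi A, so
   [D_alpha, a] = [D, a] + [alpha, a] on H0.  The right side is again a one-form
   for D, which gives the twisted order-one condition for D_alpha and the
   composition property with delta = alpha + beta.
   The grading commutes with nu^2 but not necessarily with nu.  However
   nu D nu^-1 = eps' nu^2 J D J^-1 anticommutes with it, hence so do
   nu alpha nu^-1 and nu J alpha J^-1 nu = nu^2 J (nu alpha nu^-1) J^-1. *)

Set Implicit Arguments.
Unset Strict Implicit.
Unset Printing Implicit Defensive.

Import Order.TTheory GRing.Theory Num.Theory Num.Def.
Import numFieldNormedType.Exports.

Local Open Scope classical_set_scope.
Local Open Scope ring_scope.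

(** * Hilbert space geometry: nearest points in closed subspaces *)

Section HilbertSpace.
Context {R : realType} {H : hilbertType R}.
Implicit Types (x y u v w : H) (W : set H).

Lemma innerC x y : inner x y = conjC (inner y x).
Proof. by rewrite hermC /= expr0 mul1r. Qed.

Lemma innerDl x y u : inner (x + y) u = inner x u + inner y u.
Proof. by rewrite linearDl. Qed.

Lemma innerDr x y u : inner u (x + y) = inner u x + inner u y.
Proof. by rewrite linearDr. Qed.

Lemma innerBl x y u : inner (x - y) u = inner x u - inner y u.
Proof. by rewrite linearBl. Qed.

Lemma innerBr x y u : inner u (x - y) = inner u x - inner u y.
Proof. by rewrite linearBr. Qed.

Lemma innerZl (c : R[i]) x y : inner (c *: x) y = c * inner x y.
Proof. by rewrite linearZl_LR. Qed.

Lemma innerZr (c : R[i]) x y : inner x (c *: y) = conjC c * inner x y.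
Proof. by rewrite linearZr_LR. Qed.

Lemma Re_normC (V : normedModType R[i]) (x : V) : (complex.Re `|x|)%:C%C = `|x|.
Proof. by apply: RRe_real; rewrite normr_real. Qed.

Lemma normB_sqr x y :
  `|x - y| ^+ 2 = `|x| ^+ 2 + `|y| ^+ 2 - (inner x y + conjC (inner x y)).
Proof. by rewrite -!inner_norm dnormB. Qed.

Lemma normD_sqr x y :
  `|x + y| ^+ 2 = `|x| ^+ 2 + `|y| ^+ 2 + (inner x y + conjC (inner x y)).
Proof. by rewrite -!inner_norm dnormD. Qed.

Lemma parallelogram x y :
  `|x + y| ^+ 2 + `|x - y| ^+ 2 = 2 * (`|x| ^+ 2 + `|y| ^+ 2).
Proof. rewrite normB_sqr normD_sqr; ring. Qed.

(** The choice c = <e, v> / |v|^2 lowers |e|^2 by exactly |<e, v>|^2 / |v|^2, which minimality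
    forces to vanish. *)
Lemma minimal_orthogonal e v :
  (forall c : R[i], `|e| ^+ 2 <= `|e - c *: v| ^+ 2) -> inner e v = 0.
Proof.
move=> hmin; have [->|v0] := eqVneq v 0; first by rewrite linear0r.
set a := inner e v.
have nv0 : `|v| ^+ 2 != 0 by rewrite expf_neq0 // normr_eq0.
have nvr : conjC (`|v| ^+ 2) = `|v| ^+ 2.
  by apply: CrealP; rewrite realX ?normr_real.
have := hmin (a / `|v| ^+ 2).
rewrite normB_sqr innerZr -/a normrZ exprMn normrM normfV normrX normr_id.
have -> : conjC (a / `|v| ^+ 2) = conjC a / `|v| ^+ 2.
  by rewrite rmorphM fmorphV /= nvr.
have aa : conjC a * a = `|a| ^+ 2 by rewrite normCKC.
have -> : conjC a / `|v| ^+ 2 * a = `|a| ^+ 2 / `|v| ^+ 2.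
  by rewrite -aa mulrAC.
have -> : conjC (`|a| ^+ 2 / `|v| ^+ 2) = `|a| ^+ 2 / `|v| ^+ 2.
  by apply: CrealP; rewrite realM ?realV ?realX ?normr_real.
have -> : `|e| ^+ 2 + (`|a| / `|v| ^+ 2) ^+ 2 * `|v| ^+ 2 -
    (`|a| ^+ 2 / `|v| ^+ 2 + `|a| ^+ 2 / `|v| ^+ 2) =
    `|e| ^+ 2 - `|a| ^+ 2 / `|v| ^+ 2.
  by field; rewrite expf_eq0 /= in nv0.
rewrite lerDl oppr_ge0 => h.
have : `|a| ^+ 2 / `|v| ^+ 2 == 0.
  by rewrite eq_le h divr_ge0 // exprn_ge0.
by rewrite mulf_eq0 invr_eq0 (negbTE nv0) orbF expf_eq0 /= normr_eq0 => /eqP.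
Qed.

(** Squared distances are the form in which the parallelogram law controls a minimizing sequence. *)
Lemma cauchy_sqr_cvg (u : nat -> H) (K : R) : 0 <= K ->
  (forall n m, `|u n - u m| ^+ 2 <= (K * (n.+1%:R^-1 + m.+1%:R^-1))%:C%C) ->
  cvgn u.
Proof.
move=> K0 hu; apply/cauchy_cvgP/cauchy_exP => e e0.
have [d [d0 ed]] : exists d : R, 0 < d /\ e = d%:C%C.
  exists (complex.Re e).
  have ee : (complex.Re e)%:C%C = e by apply: RRe_real; exact: gtr0_real.
  by rewrite ee; split=> //; rewrite -ltcR ee.
pose N := truncn (2 * K / d ^+ 2).
(* Beyond [N] both reciprocals are at most 1 / (N + 1), so the squared distance to [u N] is at most
   2 K / (N + 1) < d^2. *)
have hN : 2 * K / d ^+ 2 < N.+1%:R by exact: truncnS_gt.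
exists (u N), N => // n Nn; rewrite -ball_normE /=.
rewrite -(ltr_pXn2r (n := 2)) ?nnegrE ?normr_ge0 ?(ltW e0) //.
apply: le_lt_trans (hu _ _) _; rewrite ed -rmorphXn /= ltcR.
have hn : n.+1%:R^-1 <= N.+1%:R^-1 :> R.
  by rewrite lef_pV2 ?posrE ?ltr0n // ler_nat.
have Np : 0 < N.+1%:R :> R by rewrite ltr0n.
move: hN; rewrite ltr_pdivrMr ?exprn_gt0 // => hN.
have : 2 * K / N.+1%:R < d ^+ 2 by rewrite ltr_pdivrMr // [ltRHS]mulrC.
apply: le_lt_trans.
rewrite [2 * K]mulrC -mulrA ler_wpM2l //.
by rewrite mulr_natl mulr2n lerD2l.
Qed.

(** A sequence in W whose squared distances to y approach the infimum is Cauchy, because midpoints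
    stay in W; its limit lies in W by closedness and attains the infimum. *)
Lemma closed_subspace_minimizer W y : Defs.subspace W -> closed W ->
  exists2 w, W w & forall v, W v -> `|y - w| <= `|y - v|.
Proof.
move=> [W0 Wlin] cW.
have WD u v : W u -> W v -> W (u + v).
  by move=> *; rewrite -[u]scale1r; exact: Wlin.
have WZ (c : R[i]) u : W u -> W (c *: u).
  by move=> *; rewrite -[_ *: _]addr0; exact: Wlin.
(* Norms take values in [R[i]]; infima and linear arithmetic need them in the real field. *)
pose nr (x : H) : R := complex.Re `|x|.
have nrE x : (nr x)%:C%C = `|x| by exact: Re_normC.
have nr_ge0 x : 0 <= nr x by rewrite -ler0c nrE.
have nrD u v : nr (u + v) <= nr u + nr v.
  by rewrite -lecR rmorphD /= !nrE ler_normD.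
pose E := [set nr (y - w) ^+ 2 | w in W].
have Elb : lbound E 0 by move=> _ [w _ <-]; exact: sqr_ge0.
have Einf : has_inf E.
  by split; [exists (nr (y - 0) ^+ 2); exists 0 | exists 0].
pose d := inf E.
have d0 : 0 <= d by apply: lb_le_inf; [case: Einf|].
have dle v : W v -> d <= nr (y - v) ^+ 2.
  by move=> Wv; apply: ge_inf; [case: Einf | exists v].
have /choice[w hw] : forall n : nat, exists w, W w /\
    nr (y - w) ^+ 2 < d + n.+1%:R^-1.
  move=> n; have n0 : 0 < n.+1%:R^-1 :> R by rewrite invr_gt0 ltr0n.
  by have [_ [w Ww <-] hw] := inf_adherent n0 Einf; exists w.
have cw : cvgn w.
  (* By the parallelogram law, |w_m - w_n|^2 is twice the sum of the two squared distances to y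
     minus 4 times that of the midpoint. The latter is at least d, so all d cancel and 2 (1/(n+1) +
     1/(m+1)) remains. *)
  apply: (@cauchy_sqr_cvg _ 2) => // n m.
  have := parallelogram (y - w n) (y - w m).
  have -> : y - w n - (y - w m) = w m - w n by rewrite opprB addrC addrA subrK.
  have -> : y - w n + (y - w m) = (2 : R[i]) *: (y - (2 : R[i])^-1 *: (w n + w m)).
    rewrite scalerBr scalerA divff ?pnatr_eq0 // scale1r scaler_nat mulr2n opprD.
    by rewrite addrACA.
  have hmid := dle _ (WZ 2^-1 _ (WD _ _ (hw n).1 (hw m).1)).
  set z := y - _ *: _ in hmid *.
  rewrite normrZ exprMn [`|w m - w n|]distrC -!nrE.
  have -> : `|2 : R[i]| ^+ 2 = 4%:R%:C%C by rewrite normr_nat -natrX rmorph_nat.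
  have -> : (2 : R[i]) = 2%:R%:C%C by rewrite rmorph_nat.
  rewrite -!rmorphXn -?rmorphM -?rmorphD -?rmorphM -?rmorphD /= => /complexI heq.
  rewrite lecR; have := (hw n).2; have := (hw m).2; move: hmid heq.
  move: (n.+1%:R^-1) (m.+1%:R^-1) => p q; lra.
exists (limn w) => [|v Wv].
  by apply: (closed_cvg W cW _ _ cw); apply: nearW => n; case: (hw n).
set c := limn w; suff hc : nr (y - c) ^+ 2 <= d.
  rewrite -(ler_pXn2r (n := 2)) ?nnegrE // -!nrE -!rmorphXn lecR /=.
  exact: le_trans hc (dle _ Wv).
rewrite leNgt; apply/negP => hlt; set g := nr (y - c) ^+ 2 - d.
have g0 : 0 < g by rewrite subr_gt0.
(* With a = |y - w_N| <= d + 1 and b = |c - w_N| < e <= 1, this [e] makes 2ab + b^2 at most g/2. The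
   index N below makes a^2 < d + g/2, so (a + b)^2 < d + g, against the definition of g. *)
pose e := minr 1 (g / 2 / (2 * (d + 1) + 1)).
have M0 : 0 < 2 * (d + 1) + 1 by lra.
have e0 : 0 < e by rewrite lt_min ltr01 /= !divr_gt0.
have e1 : e <= 1 by rewrite ge_min lexx.
have eg : (2 * (d + 1) + 1) * e <= g / 2.
  by rewrite mulrC -ler_pdivlMr // ge_min lexx orbT.
have /cvgrPdist_lt/(_ e%:C%C) : w @ \oo --> c by exact: cw.
rewrite ltcR => /(_ e0)[N1 _ hN1].
pose N := maxn N1 (truncn (2 / g)).
have hN : 2 / g < N.+1%:R.
  by apply: lt_le_trans (truncnS_gt _) _; rewrite ler_nat ltnS leq_maxr.
have gN : N.+1%:R^-1 < g / 2.
  by rewrite -[X in _ < X]invrK invf_div ltf_pV2 ?posrE ?ltr0n ?divr_gt0.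
have hb : nr (c - w N) < e by rewrite -ltcR nrE; apply: hN1; exact: leq_maxl.
have ha := (hw N).2.
have htri : nr (y - c) <= nr (y - w N) + nr (c - w N).
  have -> : nr (c - w N) = nr (w N - c) by rewrite /nr distrC.
  by apply: le_trans (nrD _ _); rewrite addrA subrK.
have aM : nr (y - w N) <= d + 1.
  rewrite -(ler_pXn2r (n := 2)) ?nnegrE ?addr_ge0 //.
  have : N.+1%:R^-1 <= 1 :> R by rewrite invf_le1 ?ltr0n // ler1n.
  by move: (N.+1%:R^-1) ha d0 => p ha d0 p1; nra.
have := nr_ge0 (y - c); have := nr_ge0 (c - w N); have := nr_ge0 (y - w N).
set a := nr (y - w N) in ha htri aM *; set b := nr (c - w N) in hb htri *.
move=> a0 b0 c0.
have h1 : nr (y - c) ^+ 2 <= a ^+ 2 + 2 * (a * b) + b ^+ 2.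
  have -> : a ^+ 2 + 2 * (a * b) + b ^+ 2 = (a + b) ^+ 2 by ring.
  by rewrite ler_pXn2r ?nnegrE ?addr_ge0.
have h2 : a * b <= (d + 1) * e by apply: ler_pM => //; exact: ltW.
have h3 : b ^+ 2 <= e.
  by rewrite expr2 -[leRHS]mul1r; apply: ler_pM => //; lra.
by move: (N.+1%:R^-1) h1 h2 h3 ha gN eg; rewrite /g => p; lra.
Qed.

(** The difference between y and its nearest point in W is orthogonal to W, hence zero. *)
Lemma closed_subspace_total W : Defs.subspace W -> closed W ->
  (forall u, (forall w, W w -> inner u w = 0) -> u = 0) -> W = setT.
Proof.
move=> sW cW horth; apply/seteqP; split=> // y _.
have [w Ww hw] := closed_subspace_minimizer y sW cW.
suff /eqP : y - w = 0 by rewrite subr_eq0 => /eqP ->.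
apply: horth => v Wv; apply: minimal_orthogonal => c.
rewrite -addrA -opprD [w + _]addrC ler_pXn2r ?nnegrE //.
by apply: hw; exact: sW.2.
Qed.

End HilbertSpace.

(** * Bounded and compact operators, and graphs under bounded perturbation *)

Section Operators.
Context {R : realType} {H : hilbertType R}.
Implicit Types (V : set H) (T S B : H -> H) (G : set (H * H)).

Lemma linear_linear_on T : linear T -> linear_on setT T.
Proof. by move=> lT c x y _ _; exact: lT. Qed.

Section LinearOn.
Context {V : set H} {T : H -> H} (sV : Defs.subspace V) (lT : linear_on V T).

Lemma subspaceD x y : V x -> V y -> V (x + y).
Proof. by move=> Vx Vy; rewrite -[x]scale1r; exact: sV.2. Qed.

Lemma subspaceZ (c : R[i]) x : V x -> V (c *: x).
Proof. by move=> Vx; rewrite -[_ *: _]addr0; apply: sV.2 => //; exact: sV.1. Qed.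

Lemma subspaceB x y : V x -> V y -> V (x - y).
Proof. by move=> Vx Vy; rewrite -scaleN1r addrC; exact: sV.2. Qed.

Lemma subspace_sum I (s : seq I) (F : I -> H) :
  (forall i, V (F i)) -> V (\sum_(i <- s) F i).
Proof.
by move=> VF; elim/big_ind: _ => //; [exact: sV.1|exact: subspaceD].
Qed.

Lemma linear_onD x y : V x -> V y -> T (x + y) = T x + T y.
Proof. by move=> Vx Vy; rewrite -[x]scale1r lT // !scale1r. Qed.

Lemma linear_on0 : T 0 = 0.
Proof.
apply: (addrI (T 0)); rewrite -(linear_onD sV.1 sV.1) !addr0 //.
Qed.

Lemma linear_onZ (c : R[i]) x : V x -> T (c *: x) = c *: T x.
Proof.
by move=> Vx; rewrite -[_ *: x]addr0 lT ?linear_on0 ?addr0 //; exact: sV.1.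
Qed.

Lemma linear_onB x y : V x -> V y -> T (x - y) = T x - T y.
Proof.
by move=> Vx Vy; rewrite -(scaleN1r y) -(scaleN1r (T y)) addrC lT // addrC.
Qed.

Lemma linear_onN x : V x -> T (- x) = - T x.
Proof. by move=> Vx; rewrite -(scaleN1r x) -(scaleN1r (T x)) linear_onZ. Qed.

End LinearOn.

Lemma subspaceT : Defs.subspace [set: H].
Proof. by []. Qed.

(** A bound is any complex number, and only a nonzero vector of V forces it to be nonnegative;
    [|M| + 1] serves in every case. *)
Lemma bounded_on_gt0 V T : bounded_on V T ->
  exists2 M : R[i], 0 < M & forall x, V x -> `|T x| <= M * `|x|.
Proof.
move=> [M hM]; exists (`|M| + 1) => [|x Vx]; first exact: ltr_wpDl.
apply: (@le_trans _ _ (`|M| * `|x|)); last by rewrite ler_wpM2r // lerDl.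
have := hM x Vx => h; apply: le_trans (h) _.
have : 0 <= M * `|x| by apply: le_trans h; exact: normr_ge0.
by move=> /ger0_norm <-; rewrite normrM normr_id.
Qed.

Lemma bounded_on_comp T S : bounded_on setT T -> bounded_on setT S ->
  bounded_on setT (T \o S).
Proof.
move=> /bounded_on_gt0[M M0 hM] /bounded_on_gt0[N N0 hN].
exists (M * N) => x _ /=; apply: le_trans (hM _ I) _.
by rewrite -mulrA ler_pM2l //; exact: hN.
Qed.

Lemma bounded_onD V T S : bounded_on V T -> bounded_on V S ->
  bounded_on V (fun x => T x + S x).
Proof.
move=> [M hM] [N hN]; exists (M + N) => x Vx.
by rewrite mulrDl; apply: le_trans (ler_normD _ _) (lerD (hM _ Vx) (hN _ Vx)).
Qed.

Lemma bounded_onZ V (c : R[i]) T : bounded_on V T ->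
  bounded_on V (fun x => c *: T x).
Proof.
move=> [M hM]; exists (`|c| * M) => x Vx.
by rewrite normrZ -mulrA ler_wpM2l //; exact: hM.
Qed.

Lemma bounded_on_sub V W T : V `<=` W -> bounded_on W T -> bounded_on V T.
Proof. by move=> VW [M hM]; exists M => x /VW; exact: hM. Qed.

Lemma eq_bounded_on V T S : (forall x, V x -> T x = S x) ->
  bounded_on V T -> bounded_on V S.
Proof. by move=> TS [M hM]; exists M => x Vx; rewrite -TS //; exact: hM. Qed.

Lemma bounded_operator_comp T S : bounded_operator T -> bounded_operator S ->
  bounded_operator (T \o S).
Proof.
move=> [lT bT] [lS bS]; split; last exact: bounded_on_comp.
by move=> c x y /=; rewrite lS lT.
Qed.

Lemma bounded_operatorD T S : bounded_operator T -> bounded_operator S ->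
  bounded_operator (fun x => T x + S x).
Proof.
move=> [lT bT] [lS bS]; split; last exact: bounded_onD.
by move=> c x y; rewrite lS lT scalerDr addrACA.
Qed.

Lemma bounded_operatorZ (c : R[i]) T : bounded_operator T ->
  bounded_operator (fun x => c *: T x).
Proof.
move=> [lT bT]; split; last exact: bounded_onZ.
by move=> d x y; rewrite lT scalerDr !scalerA mulrC.
Qed.

Lemma bounded_operator_id : bounded_operator (@id H).
Proof. by split=> //; exists 1 => x _; rewrite mul1r. Qed.

Lemma bounded_operator_continuous T : bounded_operator T -> continuous T.
Proof.
move=> [lT /bounded_on_gt0[M M0 hM]] x; apply/cvgrPdist_lt => e e0.
have : \forall y \near x, `|x - y| < e / M.
  by apply/nbhs_ballP; exists (e / M) => /=; [exact: divr_gt0|rewrite -ball_normE].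
apply: filterS => y; rewrite ltr_pdivlMr // mulrC; apply: le_lt_trans.
rewrite -(linear_onB (linear_linear_on lT)) //; exact: hM.
Qed.

(** B sends the unit ball into M times the unit ball, so its image under S B lies in M times the
    compact closure of the image under S. *)
Lemma compact_operator_comp S B : compact_operator S -> bounded_operator B ->
  compact_operator (S \o B).
Proof.
move=> [bS kS] bB; split; first exact: bounded_operator_comp.
have [M M0 hM] := bounded_on_gt0 bB.2.
have lS := linear_linear_on bS.1.
have lB := linear_linear_on bB.1.
have cM : continuous (fun x : H => M *: x).
  exact: scaler_continuous.
have : compact ((fun x : H => M *: x) @` closure (S @` [set x | `|x| <= 1])).
  apply: continuous_compact; last by rewrite -precompactE.
  exact: continuous_subspaceT.
move=> cK.
apply: (@precompact_subset _ _ _ _ (_ : precompact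
  ((fun x : H => M *: x) @` closure (S @` [set x | `|x| <= 1])))); last first.
  by rewrite precompact_closed //; apply: compact_closed.
move=> _ [x /= x1 <-]; exists (S (M^-1 *: B x)); last first.
  rewrite (linear_onZ subspaceT lS) // scalerA divff ?scale1r //.
  by rewrite gt_eqF.
apply: subset_closure; exists (M^-1 *: B x) => //=.
rewrite normrZ normfV (gtr0_norm M0) mulrC ler_pdivrMr // mul1r.
by apply: le_trans (hM _ I) _; rewrite -[leRHS]mulr1 ler_pM2l.
Qed.

Lemma closure_preimage (X Y : topologicalType) (f : X -> Y) (E : set Y) :
  continuous f -> closure (f @^-1` E) `<=` f @^-1` closure E.
Proof.
move=> cf; rewrite [X in _ `<=` X](closure_id _).1.
  by apply: closureS => x /=; exact: subset_closure.
by apply: preimage_closed; [move=> x _; exact: cf|exact: closed_closure].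
Qed.

(** Taking the preimage under this map adds B to a relation: the graph of T + B is the preimage of
    the graph of T. *)
Definition shear B (p : H * H) : H * H := (p.1, p.2 - B p.1).

Lemma shear_continuous B : bounded_operator B -> continuous (shear B).
Proof.
move=> /bounded_operator_continuous cB p; apply: cvg_pair; first exact: cvg_fst.
apply: cvgB; first exact: cvg_snd.
by apply: continuous_comp; [exact: cvg_fst|exact: cB].
Qed.

(** The shears by B and by -B are continuous and mutually inverse; each of them gives one
    inclusion. *)
Lemma closure_graphD V T S B : bounded_operator B ->
  (forall x, V x -> S x = T x + B x) ->
  closure (graph V S) = shear B @^-1` closure (graph V T).
Proof.
move=> bB hS; have bN : bounded_operator (fun x => -1 *: B x).
  exact: bounded_operatorZ.
have gS : graph V S = shear B @^-1` graph V T.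
  apply/seteqP; split=> [] [x y] /= [Vx /= e]; split=> //=.
    by rewrite e hS // addrK.
  by rewrite hS // -e subrK.
have gT : graph V T = shear (fun x => -1 *: B x) @^-1` graph V S.
  apply/seteqP; split=> [] [x y] /= [Vx /= e]; split=> //=.
    by rewrite e hS // scaleN1r opprK.
  by apply: (addIr (B x)); rewrite -hS // -e scaleN1r opprK.
apply/seteqP; split.
  by rewrite gS; apply: closure_preimage; exact: shear_continuous.
move=> [x y] /=; rewrite gT => /(closure_preimage (shear_continuous bN)).
by rewrite /preimage /shear /= scaleN1r opprK subrK.
Qed.

(** This is (T + B)^* = T^* + B for relations: the two terms in B cancel by symmetry. *)
Lemma adjoint_graph_shear B G : bounded_selfadjoint B ->
  adjoint_graph (shear B @^-1` G) = shear B @^-1` adjoint_graph G.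
Proof.
move=> [_ saB]; apply/seteqP; split=> [] [x y] /= h [u v] /= Guv.
  have /h /= : (shear B @^-1` G) (u, v + B u) by rewrite /shear /= addrK.
  rewrite innerDl /= saB innerBr => h'; apply/eqP.
  by rewrite -subr_eq opprK h'; apply/eqP.
have /= := h _ Guv; rewrite innerBl innerBr /= saB.
by move=> /addIr.
Qed.

End Operators.

(** * Selfadjoint graphs and their resolvent at i *)

Section Resolvent.
Context {R : realType} {H : hilbertType R}.
Implicit Types (V : set H) (T S B : H -> H) (G : set (H * H)).

(** No linearity of G is assumed: an adjoint is always linear, which makes a selfadjoint G
    linear. *)
Lemma adjoint_graph_lin G (c : R[i]) x y u v :
  adjoint_graph G (x, y) -> adjoint_graph G (u, v) ->
  adjoint_graph G (c *: x + u, c *: y + v).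
Proof.
move=> h k q Gq /=; rewrite !innerDr !innerZr.
by have /= -> := h q Gq; have /= -> := k q Gq.
Qed.

Section Selfadjoint.
Variable G : set (H * H).
Hypothesis saG : adjoint_graph G = G.

Lemma selfadjoint_lin (c : R[i]) x y u v :
  G (x, y) -> G (u, v) -> G (c *: x + u, c *: y + v).
Proof. rewrite -saG; exact: adjoint_graph_lin. Qed.

Lemma selfadjoint0 : G (0, 0).
Proof. by rewrite -saG => q _ /=; rewrite !linear0r. Qed.

Lemma selfadjoint_sym x y u v : G (x, y) -> G (u, v) -> inner y u = inner x v.
Proof. by move=> Gxy; rewrite -{1}saG => /(_ _ Gxy). Qed.

(** The cross terms cancel because <y, x> is real. *)
Lemma selfadjoint_norm x y : G (x, y) ->
  `|y - 'i%R *: x| ^+ 2 = `|y| ^+ 2 + `|x| ^+ 2.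
Proof.
move=> Gxy; rewrite normB_sqr normrZ normCi mul1r.
have yx : inner y x = inner x y by exact: (selfadjoint_sym Gxy Gxy).
suff -> : inner y ('i%R *: x) + conjC (inner y ('i%R *: x)) = 0 by rewrite subr0.
rewrite innerZr rmorphM /= conjCK conjCi -innerC yx mulNr; exact: addNr.
Qed.

Lemma selfadjoint_lower x y : G (x, y) -> `|x| <= `|y - 'i%R *: x|.
Proof.
move=> Gxy; rewrite -(ler_pXn2r (n := 2)) ?nnegrE //.
by rewrite selfadjoint_norm // lerDr exprn_ge0.
Qed.

Lemma selfadjoint_lower2 x y : G (x, y) -> `|y| <= `|y - 'i%R *: x|.
Proof.
move=> Gxy; rewrite -(ler_pXn2r (n := 2)) ?nnegrE //.
by rewrite selfadjoint_norm // lerDl exprn_ge0.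
Qed.

Lemma selfadjointB x y u v : G (x, y) -> G (u, v) -> G (x - u, y - v).
Proof.
move=> Gxy Guv; rewrite ![_ - _]addrC -(scaleN1r u) -(scaleN1r v).
exact: selfadjoint_lin.
Qed.

Lemma selfadjoint_inj x y u v : G (x, y) -> G (u, v) ->
  y - 'i%R *: x = v - 'i%R *: u -> x = u.
Proof.
move=> Gxy Guv e; apply/eqP; rewrite -subr_eq0 -normr_le0.
apply: le_trans (selfadjoint_lower (selfadjointB Gxy Guv)) _.
have -> : y - v - 'i%R *: (x - u) = (y - 'i%R *: x) - (v - 'i%R *: u).
  by rewrite scalerBr !opprB addrACA [RHS]addrACA [- v - _]addrC.
by rewrite e subrr normr0.
Qed.

Let range : set H := [set p.2 - 'i%R *: p.1 | p in G].

(** By the lower bounds, both entries of a pair (x, y) in G are 1-Lipschitz functions of y - i x. A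
    filter on the range converging to w therefore lifts to a convergent one on G, whose limit is a
    preimage of w since G is closed. *)
Lemma selfadjoint_range_closed : closed G -> closed range.
Proof.
move=> cG w; rewrite closureEcvg => -[F PF [Fw FW]].
(* [s] selects a preimage in G; off the range its value (0, 0) is a mere filler. *)
have /choice[s hs] : forall v, exists p : H * H,
    range v -> G p /\ p.2 - 'i%R *: p.1 = v.
  move=> v; have [[p Gp e]|nv] := pselect (range v); first by exists p.
  by exists (0, 0).
have Frange : F range by exact: FW.
have cvgF (f : H -> H) :
    (forall u v, range u -> range v -> `|f u - f v| <= `|u - v|) -> cvg (f @ F).
  move=> hf; apply/cauchy_cvgP/cauchy_exP => e e0.
  have e20 : 0 < e / 2 by exact: divr_gt0.
  have /cvgrPdist_lt/(_ _ e20) Fe : id @ F --> w by [].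
  have [v0 [h0 r0]] := filter_ex (filterI Fe Frange).
  exists (f v0); rewrite /fmap /= nbhs_simpl.
  near=> v; rewrite -ball_normE /=.
  apply: le_lt_trans (hf _ _ r0 _) _; first by near: v.
  rewrite (splitr e) -(subrK w v0) -addrA; apply: le_lt_trans (ler_normD _ _) _.
  by rewrite distrC ltrD //; near: v.
have sB u v : range u -> range v -> G ((s u).1 - (s v).1, (s u).2 - (s v).2) /\
    u - v = ((s u).2 - (s v).2) - 'i%R *: ((s u).1 - (s v).1).
  move=> /hs[Gu eu] /hs[Gv ev]; split.
    by apply: selfadjointB; rewrite -surjective_pairing.
  rewrite -{1}eu -{1}ev scalerBr !opprB addrACA [RHS]addrACA.
  by congr (_ + _); exact: addrC.
have c1 : cvg ((fun v => (s v).1) @ F).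
  apply: cvgF => u v ru rv; have [h ->] := sB u v ru rv.
  exact: selfadjoint_lower.
have c2 : cvg ((fun v => (s v).2) @ F).
  apply: cvgF => u v ru rv; have [h ->] := sB u v ru rv.
  exact: selfadjoint_lower2.
set x := lim ((fun v => (s v).1) @ F) in c1.
set y := lim ((fun v => (s v).2) @ F) in c2.
exists (x, y).
  have c : (fun v => ((s v).1, (s v).2)) @ F --> (x, y) by exact: cvg_pair.
  apply: (closed_cvg G cG _ _ c).
  by apply: filterS Frange => v /hs[]; rewrite -surjective_pairing.
have cy : (fun v => (s v).2 - 'i%R *: (s v).1) @ F --> y - 'i%R *: x.
  apply: cvgB; first exact: c2.
  by apply: cvg_comp c1 _; exact: scaler_continuous.
apply: (cvg_unique _ cy) => //.
apply: cvg_trans Fw; apply: near_eq_cvg.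
by apply: filterS Frange => v /hs[_ ->].
Unshelve. all: by end_near. Qed.

Lemma selfadjoint_range : closed G -> range = setT.
Proof.
move=> cG; apply: closed_subspace_total.
- split; first by exists (0, 0); [exact: selfadjoint0|rewrite /= scaler0 subr0].
  move=> c _ _ [[x y] Gxy <-] [[u v] Guv <-].
  exists (c *: x + u, c *: y + v); first exact: selfadjoint_lin.
  by rewrite /= scalerDr scalerBr !scalerA mulrC opprD addrACA.
- exact: selfadjoint_range_closed.
(* Orthogonality to the range of G - i says that u is an eigenvector of the adjoint, hence of G, for
   -i. Symmetry then gives -i |u|^2 = i |u|^2. *)
move=> u hu; have Gu : G (u, - 'i%R *: u).
  rewrite -saG => -[x y] Gxy /=.
  have : inner u (y - 'i%R *: x) = 0 by apply: hu; exists (x, y).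
  rewrite innerC => /(congr1 conjC); rewrite conjCK conjC0.
  rewrite innerBl /= innerZl innerZr rmorphN /= conjCi opprK => /eqP.
  by rewrite subr_eq0 => /eqP.
have := selfadjoint_sym Gu Gu.
rewrite innerZl innerZr rmorphN /= conjCi opprK mulNr inner_norm => /eqP.
rewrite eq_sym -subr_eq0 opprK -mulr2n mulrn_eq0 /= mulf_eq0 (negPf (neq0Ci _)) /=.
by rewrite expf_eq0 /= normr_eq0 => /eqP.
Qed.

(** Surjectivity of G - i defines S, injectivity makes it linear, and the lower bound gives norm at
    most 1. *)
Lemma selfadjoint_resolvent : closed G ->
  exists S, is_resolvent G 'i%R S /\ bounded_operator S.
Proof.
move=> cG; have /choice[S hS] : forall y, exists x, G (x, y + 'i%R *: x).
  move=> y; have : range y by rewrite selfadjoint_range.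
  by move=> [[x z] Gxz <-]; exists x; rewrite /= subrK.
exists S; split; first split=> [//|x y Gxy].
  by apply: (selfadjoint_inj (hS _) Gxy); rewrite addrK.
split=> [c x y|]; last first.
  exists 1 => x _; rewrite mul1r.
  by apply: le_trans (selfadjoint_lower (hS x)) _; rewrite addrK.
apply: (selfadjoint_inj (hS _) (selfadjoint_lin c (hS x) (hS y))).
by rewrite addrK !scalerDr !scalerA [c * _]mulrC addrACA addrK //.
Qed.

End Selfadjoint.

Lemma essentially_selfadjointD V T S B : bounded_selfadjoint B ->
  (forall x, V x -> S x = T x + B x) ->
  essentially_selfadjoint V T -> essentially_selfadjoint V S.
Proof.
move=> bsB hS; rewrite /essentially_selfadjoint (closure_graphD bsB.1 hS) => e.
by rewrite adjoint_graph_shear // e.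
Qed.

(* With G the closure of T, the resolvent S' of G + B at i exists because G + B
   is selfadjoint, and S' = S (1 + (i - z) S' - B S') for S the given compact
   resolvent (G - z)^-1. *)
Lemma compact_resolventD V T S B : bounded_selfadjoint B ->
  (forall x, V x -> S x = T x + B x) ->
  essentially_selfadjoint V T -> compact_resolvent V T -> compact_resolvent V S.
Proof.
move=> bsB hS esT [z [S0 [[r1 r2] kS0]]].
have cS := closure_graphD bsB.1 hS.
have esS := essentially_selfadjointD bsB hS esT.
have [S' [[hS1 hS2] bS']] := selfadjoint_resolvent esS (@closed_closure _ _).
exists 'i%R, S'; split=> //.
pose K y := y + (('i%R - z) *: S' y + -1 *: B (S' y)).
have bK : bounded_operator K.
  apply: bounded_operatorD; first exact: bounded_operator_id.
  apply: bounded_operatorD; first exact: bounded_operatorZ.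
  by apply: bounded_operatorZ; exact: (bounded_operator_comp bsB.1 bS').
have -> : S' = S0 \o K; last exact: compact_operator_comp.
apply/funext => y /=; have := hS1 y; rewrite cS => /= /r2 /= <-.
congr S0; rewrite /K scaleN1r scalerBl -!addrA.
by do 2 congr (_ + _); rewrite addrC.
Qed.

End Resolvent.

(** * Rules for [J], [nu] and [pi] on [H0] *)

Section Fluctuation.
Context {R : realType} {A : starAlgType R[i]} {H : hilbertType R}.
Variables (pi : A -> H -> H) (H0 : set H) (V : set H) (nu J : H -> H).
Variables (D : H -> H) (eps eps' : bool).
Hypothesis hD : twisted_real_spectral_triple pi H0 V nu J D eps eps'.
Implicit Types (a b c : A) (x y : H) (f g alpha : H -> H) (s : seq (A * A)).

Local Notation Jinv := (pinv setT J).
Local Notation nuinv := (pinv V nu).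

Let trip : spectral_triple pi H0 D. Proof. by case: hD => -[]. Qed.
Let tw : twist pi H0 V nu. Proof. by case: hD => -[]. Qed.
Let sH0 : Defs.subspace H0. Proof. by case: trip => _ []. Qed.
Let DH0 x : H0 x -> H0 (D x). Proof. by case: hD => _ _ [+ _ _] _ _; exact. Qed.
Let JH0 x : H0 x -> H0 (J x). Proof. by case: hD => _ _ [_ + _] _ _; exact. Qed.
Let nuH0 x : H0 x -> H0 (nu x). Proof. by case: hD => _ _ [_ _ +] _ _; exact. Qed.
Let piH0 a x : H0 x -> H0 (pi a x).
Proof. by case: trip => _ _ _ _ /(_ a)[+ _]; exact. Qed.
Let lD : linear_on H0 D. Proof. by case: trip => _ _ []. Qed.
Let bpi a : bounded_operator (pi a). Proof. by case: trip => -[]. Qed.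
Let lpi a : linear_on setT (pi a). Proof. exact: linear_linear_on (bpi a).1. Qed.
Let lnu : linear_on H0 nu.
Proof. by case: tw => -[_ sub] [l _] _ _ _ c x y /sub ? /sub ?; exact: l. Qed.
Let Jlin (c : R[i]) x y : J (c *: x + y) = conjC c *: J x + J y.
Proof. by case: hD => _ [[]]. Qed.
Let JJ x : J (J x) = (-1) ^+ eps *: x. Proof. by case: hD => _ []. Qed.
Let Jbij : bijective J. Proof. by case: hD => _ [[]]. Qed.
Let DJnu x : H0 x -> D (J (nu x)) = (-1) ^+ eps' *: nu (J (D x)).
Proof. by case: hD => _ _ _ _ [+ _]; exact. Qed.
Let nuJnu x : H0 x -> nu (J (nu x)) = J x.
Proof. by case: hD => _ _ _ _ [_ +]; exact. Qed.

Let piD a x y : pi a (x + y) = pi a x + pi a y. Proof. exact: linear_onD. Qed.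
Let piB a x y : pi a (x - y) = pi a x - pi a y. Proof. exact: linear_onB. Qed.
Let piZ a (c : R[i]) x : pi a (c *: x) = c *: pi a x.
Proof. exact: (linear_onZ subspaceT). Qed.
Let pi0 a : pi a 0 = 0. Proof. exact: (linear_on0 subspaceT). Qed.
Let piM a b x : pi (amul a b) x = pi a (pi b x). Proof. by case: trip => -[]. Qed.
Let piN a x : pi (- a) x = - pi a x.
Proof.
case: trip => -[_ lin _ _] _ _ _ _.
have p0 : pi 0 x = 0.
  have := lin 1 0 0 x; rewrite !scale1r addr0 => /eqP.
  by rewrite -subr_eq0 opprD addrA subrr sub0r oppr_eq0 => /eqP.
by have := lin (-1) a 0 x; rewrite p0 !addr0 !scaleN1r.
Qed.

Let JD x y : J (x + y) = J x + J y.
Proof. by rewrite -[x in LHS]scale1r Jlin conjC1 scale1r. Qed.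
Let J0 : J 0 = 0.
Proof. by apply: (addrI (J 0)); rewrite -JD !addr0. Qed.
Let JZ (c : R[i]) x : J (c *: x) = conjC c *: J x.
Proof. by rewrite -[_ *: x]addr0 Jlin J0 addr0. Qed.
Let Jsign (b : bool) x : J ((-1) ^+ b *: x) = (-1) ^+ b *: J x.
Proof. by rewrite JZ rmorph_sign. Qed.
Let signK (b : bool) x : (-1) ^+ b *: ((-1) ^+ b *: x) = x :> H.
Proof. by rewrite scalerA -signr_addb addbb scale1r. Qed.
Let JinvE x : Jinv x = (-1) ^+ eps *: J x.
Proof.
have [g gK Kg] := Jbij; rewrite -{1}[x](signK eps) -JJ -Jsign.
by apply: pinvKV; rewrite ?inE // => u v _ _; exact: (can_inj gK).
Qed.
Let JinvK x : J (Jinv x) = x. Proof. by rewrite JinvE Jsign JJ signK. Qed.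
Let JKinv x : Jinv (J x) = x. Proof. by rewrite JinvE JJ signK. Qed.
Let JinvH0 x : H0 x -> H0 (Jinv x).
Proof. by move=> H0x; rewrite JinvE; apply: subspaceZ => //; exact: JH0. Qed.
Let JinvD x y : Jinv (x + y) = Jinv x + Jinv y.
Proof. by rewrite !JinvE JD scalerDr. Qed.
Let JB x y : J (x - y) = J x - J y.
Proof. by rewrite JD -(scaleN1r y) JZ rmorphN1 scaleN1r. Qed.

Let nuK x : H0 x -> nuinv (nu x) = x.
Proof.
move=> H0x; case: tw => -[_ sub] _ inj _ _.
apply: pinvKV; last by rewrite inE; exact: sub.
by move=> u v; rewrite !inE; exact: inj.
Qed.
(** Twisted regularity at J^-1 x. The formula shows that [nuinv] preserves [H0], which is not among
    the axioms. *)
Let nuinvE x : H0 x -> nuinv x = J (nu (Jinv x)).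
Proof.
move=> H0x; have H0y : H0 (Jinv x) by exact: JinvH0.
by rewrite -[in LHS](JinvK x) -nuJnu // nuK //; apply/JH0/nuH0.
Qed.
Let nuinvH0 x : H0 x -> H0 (nuinv x).
Proof. by move=> H0x; rewrite nuinvE //; apply/JH0/nuH0/JinvH0. Qed.
Let nuinvK x : H0 x -> nu (nuinv x) = x.
Proof. by move=> H0x; rewrite nuinvE // nuJnu ?JinvK //; exact: JinvH0. Qed.

Let nuinvZ (c : R[i]) x : H0 x -> nuinv (c *: x) = c *: nuinv x.
Proof.
move=> H0x; have H0y := JinvH0 H0x.
rewrite !nuinvE //; last exact: subspaceZ.
rewrite [Jinv (c *: x)]JinvE JZ scalerA mulrC -scalerA -JinvE.
by rewrite (linear_onZ sH0 lnu) // JZ conjCK.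
Qed.

Variable nuhat : A -> A.
Hypothesis nuhat_auto : algebra_automorphism nuhat.
Hypothesis nuhatE : forall a x, H0 x -> pi (nuhat a) x = nubar V nu (pi a) x.

Let nu_pi a x : H0 x -> nu (pi a x) = pi (nuhat a) (nu x).
Proof. by move=> H0x; rewrite nuhatE ?nuK /nubar /= ?nuK //; exact: nuH0. Qed.

Let nuinv_pi a x : H0 x -> nuinv (pi (nuhat a) x) = pi a (nuinv x).
Proof.
by move=> H0x; rewrite nuhatE // /nubar /= nuK //; apply/piH0/nuinvH0.
Qed.

(** Turns the twist in the order-one condition into an algebra element, with no inverse of [nu]
    left. *)
Let nubar2E b x : H0 x ->
  nubar V nu (nubar V nu (pi b)) x = pi (nuhat (nuhat b)) x.
Proof.
move=> H0x; have H0y := nuinvH0 H0x.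
transitivity (nu (nubar V nu (pi b) (nuinv x))) => //.
by rewrite -nuhatE // nu_pi // nuinvK.
Qed.

(** * Order conditions and the bimodule of one-forms *)

Let opH0 a x : H0 x -> H0 (opcomm D (pi a) x).
Proof. by move=> H0x; apply: subspaceB => //; auto. Qed.

Let order_zero a b x : pi a (J (pi b (Jinv x))) = J (pi b (Jinv (pi a x))).
Proof.
by case: hD => _ _ _ [oz _] _; apply/eqP; rewrite -subr_eq0; apply/eqP/oz.
Qed.

Let order_one a b x : H0 x ->
  opcomm D (pi a) (J (pi (nuhat (nuhat b)) (Jinv x))) =
  J (pi b (Jinv (opcomm D (pi a) x))).
Proof.
case: hD => _ _ _ [_ o1] _ H0x; rewrite -o1 // nubar2E //; exact: JinvH0.
Qed.

(** Keeping the coefficient list as data, apart from boundedness, reduces closure properties of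
    one-forms to operations on lists. *)
Definition formal_form s x := \sum_(ab <- s) pi ab.1 (opcomm D (pi ab.2) x).

Let form_cat s t x : formal_form (s ++ t) x = formal_form s x + formal_form t x.
Proof. by rewrite /formal_form big_cat. Qed.

Let form_cons a b s x :
  formal_form ((a, b) :: s) x = pi a (opcomm D (pi b) x) + formal_form s x.
Proof. by rewrite /formal_form big_cons. Qed.

Let form_nil x : formal_form [::] x = 0.
Proof. by rewrite /formal_form big_nil. Qed.

Lemma formal_form_dom s x : H0 x -> H0 (formal_form s x).
Proof. by move=> H0x; apply: subspace_sum => // ab; apply/piH0/opH0. Qed.

(** The Leibniz rule, source of the right module structure. *)
Lemma opcommM a b x :
  opcomm D (pi (amul a b)) x = pi a (opcomm D (pi b) x) + opcomm D (pi a) (pi b x).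
Proof. by rewrite /opcomm !piM piB [RHS]addrC addrA subrK. Qed.

Lemma formal_form_left a s :
  exists t, forall x, formal_form t x = pi a (formal_form s x).
Proof.
elim: s => [|[c d] s [t IH]]; first by exists [::] => x; rewrite !form_nil pi0.
by exists ((amul a c, d) :: t) => x; rewrite !form_cons piD IH piM.
Qed.

Lemma formal_formN s : exists t, forall x, formal_form t x = - formal_form s x.
Proof.
elim: s => [|[c d] s [t IH]]; first by exists [::] => x; rewrite !form_nil oppr0.
by exists ((- c, d) :: t) => x; rewrite !form_cons IH opprD piN.
Qed.

(* [D, d] b = [D, d b] - d [D, b]. *)
Lemma formal_form_right b s :
  exists t, forall x, formal_form t x = formal_form s (pi b x).
Proof.
elim: s => [|[c d] s [t IH]]; first by exists [::] => x; rewrite !form_nil.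
exists ([:: (c, amul d b); (- amul c d, b)] ++ t) => x.
rewrite form_cat !form_cons form_nil addr0 IH; congr (_ + _).
by rewrite opcommM piD piN piM addrAC subrr add0r.
Qed.

Lemma formal_form_opcomm b s :
  exists t, forall x, formal_form t x = opcomm (formal_form s) (pi b) x.
Proof.
have [r hr] := formal_form_right b s; have [l hl] := formal_form_left b s.
have [n hn] := formal_formN l.
by exists (r ++ n) => x; rewrite form_cat hr hn hl.
Qed.

(** The order-one condition moves J b J^-1 across each [D, d], and the order-zero condition moves it
    across the coefficient c. *)
Lemma formal_form_order_one s b x : H0 x ->
  formal_form s (J (pi (nuhat (nuhat b)) (Jinv x))) =
  J (pi b (Jinv (formal_form s x))).
Proof.
move=> H0x; elim: s => [|[c d] s IH].
  by rewrite !form_nil JinvE J0 scaler0 pi0 J0.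
by rewrite !form_cons IH order_one // order_zero JinvD piD JD.
Qed.

(** * Fluctuation by one one-form *)

Section OneForm.
Variables (alpha : H -> H) (s : seq (A * A)).
Hypothesis alphaE : forall x, H0 x -> alpha x = formal_form s x.
Hypothesis balpha : bounded_operator alpha.

Let lalpha : linear_on setT alpha. Proof. exact: linear_linear_on balpha.1. Qed.
Let alphaH0 x : H0 x -> H0 (alpha x).
Proof. by move=> H0x; rewrite alphaE //; exact: formal_form_dom. Qed.
Let alphaZ (c : R[i]) x : alpha (c *: x) = c *: alpha x.
Proof. exact: (linear_onZ subspaceT). Qed.

Local Notation fl := (fluctuation nu J eps' alpha).
Let fl2 x := nu (J (alpha (Jinv (nu x)))).

Let fl2H0 x : H0 x -> H0 (fl2 x).
Proof. by move=> H0x; apply/nuH0/JH0/alphaH0/JinvH0/nuH0. Qed.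

Lemma fluctuation_dom x : H0 x -> H0 (fl x).
Proof.
move=> H0x; apply: subspaceD => //; first exact: alphaH0.
by apply: subspaceZ => //; exact: fl2H0.
Qed.

Let JalphaJinv x : J (alpha (Jinv x)) = Jinv (alpha (J x)).
Proof. by rewrite [Jinv x]JinvE alphaZ Jsign -JinvE. Qed.

(** Write a = nuhat b, as [nuhat] is onto. The inner [nu] turns a into nuhat^2 b, the order-one
    condition for [alpha] turns that into b, and the outer [nu] turns b back into a. *)
Let fl2_pi a x : H0 x -> fl2 (pi a x) = pi a (fl2 x).
Proof.
case: nuhat_auto => -[g _ gK] _ _ H0x; rewrite /fl2 -(gK a); set b := g a.
have H0y := nuH0 H0x; have H0Jy := JH0 H0y.
rewrite nu_pi // !JalphaJinv -(nu_pi b); last exact/JinvH0/alphaH0.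
congr nu; have := formal_form_order_one s b H0Jy; rewrite JKinv.
rewrite -!alphaE // => [->|]; last exact/JH0/piH0.
by rewrite JKinv.
Qed.

(* The twisted order-one condition makes the term nu J alpha J^-1 nu commute
   with pi A, so that [D_alpha, a] = [D + alpha, a]. *)
Lemma fluctuated_opcomm a x : H0 x ->
  opcomm (fluctuated nu J D eps' alpha) (pi a) x =
  opcomm D (pi a) x + opcomm (formal_form s) (pi a) x.
Proof.
move=> H0x; rewrite /opcomm /fluctuated /fluctuation.
rewrite -/(fl2 _) -/(fl2 _) fl2_pi // !piD piZ !addrA.
rewrite !alphaE //; last exact: piH0.
by rewrite opprD addrACA subrr addr0 opprD addrACA -!addrA.
Qed.

Lemma fluctuated_order_one a b x : H0 x ->
  opcomm (fluctuated nu J D eps' alpha) (pi a)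
    (J (nubar V nu (nubar V nu (pi b)) (Jinv x))) =
  J (pi b (Jinv (opcomm (fluctuated nu J D eps' alpha) (pi a) x))).
Proof.
move=> H0x; rewrite nubar2E; last exact: JinvH0.
rewrite !fluctuated_opcomm //; last exact/JH0/piH0/JinvH0.
have [t ht] := formal_form_opcomm a s.
by rewrite -!ht order_one // formal_form_order_one // JinvD piD JD.
Qed.

(** The condition holds for D already; by regularity and J^2 = eps, the two terms of the fluctuation
    are exchanged. *)
Lemma fluctuated_twisted_eps x : H0 x ->
  fluctuated nu J D eps' alpha (J (nu x)) =
  (-1) ^+ eps' *: nu (J (fluctuated nu J D eps' alpha x)).
Proof.
move=> H0x; have H0Dx := DH0 H0x; have H0ax := alphaH0 H0x.
have H0w := alphaH0 (JinvH0 (nuH0 H0x)); have H0Jw := JH0 H0w.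
have H0z : H0 ((-1) ^+ eps' *: fl2 x) by apply: subspaceZ; auto.
have nuJD u v : H0 u -> H0 v -> nu (J (u + v)) = nu (J u) + nu (J v).
  by move=> H0u H0v; rewrite JD (linear_onD lnu) //; exact: JH0.
rewrite /fluctuated /fluctuation DJnu // nuJnu // JKinv -/(fl2 x).
rewrite !nuJD //; last exact: subspaceD.
rewrite !scalerDr; congr (_ + _); rewrite addrC; congr (_ + _).
rewrite Jsign (linear_onZ sH0 lnu) ?signK; last exact/JH0/fl2H0.
by rewrite nuJnu // JJ -alphaZ JinvE signK.
Qed.

Lemma fluctuation_anticomm (gamma : H -> H) (eps'' : bool) :
  even_with_grading pi H0 nu J D gamma eps'' ->
  forall x, H0 x -> gamma (fl x) = - fl (gamma x).
Proof.
move=> [[[[lg' _] _] _] gpi' [gH0 gD] gnu gJ] x H0x.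
have lg := linear_linear_on lg'.
have gpi a y : gamma (pi a y) = pi a (gamma y).
  by apply/eqP; rewrite -subr_eq0; apply/eqP/gpi'.
have gB u v : gamma (u - v) = gamma u - gamma v by exact: (linear_onB lg).
have gD' u v : gamma (u + v) = gamma u + gamma v by exact: (linear_onD lg).
have gZ (c : R[i]) u : gamma (c *: u) = c *: gamma u.
  exact: (linear_onZ subspaceT).
have g0 : gamma 0 = 0 by exact: (linear_on0 subspaceT).
have gJinv y : gamma (Jinv y) = (-1) ^+ eps'' *: Jinv (gamma y).
  by rewrite !JinvE gZ gJ !scalerA mulrC.
have JN u : J (- u) = - J u by rewrite -sub0r JB J0 sub0r.
have nuN u : H0 u -> nu (- u) = - nu u by exact: (linear_onN sH0 lnu).
have H0N u : H0 u -> H0 (- u).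
  by move=> H0u; rewrite -sub0r; apply: subspaceB => //; exact: sH0.1.
pose conj f y := nu (nu (J (f (Jinv y)))).
(* nu^2 commutes with [gamma], and the signs eps'' produced by J and J^-1 cancel. *)
have anticomm_conj f : (forall y, H0 y -> H0 (f y)) ->
    (forall (c : R[i]) y, H0 y -> f (c *: y) = c *: f y) ->
    (forall y, H0 y -> gamma (f y) = - f (gamma y)) ->
    forall y, H0 y -> gamma (conj f y) = - conj f (gamma y).
  move=> fH0 fZ gf y H0y; have H0z := JinvH0 H0y; have H0gy := JinvH0 (gH0 _ H0y).
  have H0fgy := JH0 (fH0 _ H0gy).
  rewrite /conj -gnu; last exact/JH0/fH0.
  rewrite gJ gf // gJinv fZ // JN Jsign scalerN signK.
  by rewrite !nuN //; exact: nuH0.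
have nuDE y : H0 y -> nu (D (nuinv y)) = (-1) ^+ eps' *: conj D y.
  move=> H0y; have H0z := JinvH0 H0y; rewrite nuinvE // DJnu //.
  by rewrite (linear_onZ sH0 lnu) //; exact/nuH0/JH0/DH0.
have gnuD y : H0 y -> gamma (nu (D (nuinv y))) = - nu (D (nuinv (gamma y))).
  move=> H0y; rewrite !nuDE ?gZ ?anticomm_conj ?scalerN //; last exact: gH0.
  by move=> c u H0u; exact: (linear_onZ sH0 lD).
have nuB u v : H0 u -> H0 v -> nu (u - v) = nu u - nu v by exact: (linear_onB lnu).
(* Conjugation by [nu] turns [D, b] into the commutator of nu D nu^-1 with nuhat b, and [gamma]
   anticommutes with the former and commutes with the latter. *)
have nuopE b y : H0 y -> nu (opcomm D (pi b) (nuinv y)) =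
    opcomm (nu \o D \o nuinv) (pi (nuhat b)) y.
  move=> H0y; have H0z := nuinvH0 H0y; rewrite /opcomm nuB; [|by auto..].
  by rewrite /= nuinv_pi // nu_pi //; exact: DH0.
have gnuop b y : H0 y -> gamma (nu (opcomm D (pi b) (nuinv y))) =
    - nu (opcomm D (pi b) (nuinv (gamma y))).
  move=> H0y; rewrite !nuopE //; last exact: gH0.
  rewrite /opcomm /= gB gpi !gnuD ?gpi ?(linear_onN subspaceT (lpi _)) ?opprD //.
  exact: piH0.
have gnualpha y : H0 y ->
    gamma (nu (alpha (nuinv y))) = - nu (alpha (nuinv (gamma y))).
  move=> H0y; have H0gy := gH0 _ H0y.
  have H0z := nuinvH0 H0y; have H0gz := nuinvH0 H0gy.
  rewrite !alphaE //; elim: s => [|[c d] t IH].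
    by rewrite !form_nil (linear_on0 sH0 lnu) g0 oppr0.
  have H0c z : H0 z -> H0 (pi c (opcomm D (pi d) z)) by auto.
  have H0t z : H0 z -> H0 (formal_form t z) by exact: formal_form_dom.
  rewrite !form_cons !(linear_onD lnu); [|by auto..].
  rewrite gD' IH opprD !nu_pi; [|by auto..].
  by rewrite gpi gnuop // (linear_onN subspaceT (lpi _)).
have galpha y : H0 y -> gamma (alpha y) = - alpha (gamma y).
  move=> H0y; rewrite !alphaE //; last exact: gH0.
  elim: s => [|[c d] t IH]; first by rewrite !form_nil g0 oppr0.
  rewrite !form_cons gD' IH opprD gpi /opcomm gB gpi !gD ?gpi //; last exact: piH0.
  by rewrite !piB !(linear_onN subspaceT (lpi _)) // opprD.
(* Uses nu^-1 J^-1 = J^-1 nu on the right of [alpha] and nu J nu = J on its left. *)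
have fl2E y : H0 y -> fl2 y = conj (fun z => nu (alpha (nuinv z))) y.
  move=> H0y; have H0z := JinvH0 H0y; rewrite /conj /fl2.
  have -> : nuinv (Jinv y) = Jinv (nu y).
    have -> : nuinv (Jinv y) = J (nu ((-1) ^+ eps *: y)).
      by rewrite nuinvE // !JinvE Jsign signK JJ.
    by rewrite (linear_onZ sH0 lnu) // Jsign -JinvE.
  by rewrite [in RHS]nuJnu //; apply/alphaH0/JinvH0/nuH0.
rewrite /fluctuation gD' galpha // gZ -!/(fl2 _) opprD -scalerN; congr (_ + _ *: _).
rewrite !fl2E //; last exact: gH0.
apply: anticomm_conj => // [y H0y|c y H0y].
- exact/nuH0/alphaH0/nuinvH0.
- have H0z := nuinvH0 H0y.
  by rewrite nuinvZ // alphaZ (linear_onZ sH0 lnu) //; exact: alphaH0.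
Qed.

Lemma fluctuated_triple : selfadjoint_fluctuation H0 nu J eps' alpha ->
  twisted_real_spectral_triple pi H0 V nu J
    (fluctuated nu J D eps' alpha) eps eps'.
Proof.
move=> [S [saS SE]]; have lS := linear_linear_on saS.1.1.
(* Only [S] is known to be bounded and selfadjoint on all of H, as the perturbation lemmas require;
   on [H0] it agrees with the fluctuation. *)
have DalphaE x : H0 x -> fluctuated nu J D eps' alpha x = D x + S x.
  by move=> H0x; rewrite /fluctuated SE.
case: trip => rep dom [_ esD] crD bD.
split; first split=> //.
- split=> //.
  + split; last exact: essentially_selfadjointD saS DalphaE esD.
    move=> c x y H0x H0y; rewrite !DalphaE //; last exact: sH0.2.
    by rewrite lD // lS // scalerDr addrACA.
  + exact: compact_resolventD saS DalphaE esD crD.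
  + move=> a; split=> [x|]; first exact: piH0.
    have bSa : bounded_on setT (opcomm S (pi a)).
      apply: (@eq_bounded_on _ _ _ (fun x => S (pi a x) + -1 *: pi a (S x))).
        by move=> x _; rewrite scaleN1r.
      apply: bounded_onD; first exact: (bounded_on_comp saS.1.2 (bpi a).2).
      by apply: bounded_onZ; exact: (bounded_on_comp (bpi a).2 saS.1.2).
    apply: eq_bounded_on (bounded_onD (bD a).2 (bounded_on_sub (@subsetT _ H0) bSa)).
    move=> x H0x; rewrite /opcomm !DalphaE //; last exact: piH0.
    by rewrite piD opprD addrACA.
- by case: hD.
- split=> //; move=> x H0x; apply: subspaceD => //; first exact: DH0.
  exact: fluctuation_dom.
- split; first by case: hD => _ _ _ [].
  exact: fluctuated_order_one.
- split; first exact: fluctuated_twisted_eps.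
  exact: nuJnu.
Qed.

Lemma fluctuated_even (gamma : H -> H) (eps'' : bool) :
  even_with_grading pi H0 nu J D gamma eps'' ->
  even_with_grading pi H0 nu J (fluctuated nu J D eps' alpha) gamma eps''.
Proof.
move=> ev; have gfl := fluctuation_anticomm ev.
case: ev => [[sag gg] gpi [gH0 gD] gnu gJ]; split=> //; split=> // x H0x.
rewrite /fluctuated opprD -gfl // -gD //.
exact: (linear_onD (linear_linear_on sag.1.1)).
Qed.

(** Each c [D_alpha, d] is c [D, d] plus c times the commutator of a one-form with d, so one-forms
    for D_alpha are one-forms for D. *)
Lemma fluctuated_form r : exists t, forall x, H0 x ->
  \sum_(ab <- r) pi ab.1 (opcomm (fluctuated nu J D eps' alpha) (pi ab.2) x) =
  formal_form t x.
Proof.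
elim: r => [|[c d] r [t IH]].
  by exists [::] => x _; rewrite big_nil form_nil.
have [u hu] := formal_form_opcomm d s; have [v hv] := formal_form_left c u.
exists ((c, d) :: v ++ t) => x H0x.
by rewrite big_cons IH // form_cons form_cat hv hu fluctuated_opcomm // piD addrA.
Qed.

End OneForm.

(** * Additivity of fluctuations and their composition *)

Lemma fluctuationD f g x :
  (forall y, H0 y -> H0 (f y)) -> (forall y, H0 y -> H0 (g y)) -> H0 x ->
  fluctuation nu J eps' (fun y => f y + g y) x =
  fluctuation nu J eps' f x + fluctuation nu J eps' g x.
Proof.
move=> fH0 gH0 H0x; have H0y := JinvH0 (nuH0 H0x).
rewrite /fluctuation JD (linear_onD lnu); [|exact/JH0/fH0|exact/JH0/gH0].
by rewrite scalerDr addrACA.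
Qed.

End Fluctuation.

Lemma bounded_selfadjointD (R : realType) (H : hilbertType R) (S T : H -> H) :
  bounded_selfadjoint S -> bounded_selfadjoint T ->
  bounded_selfadjoint (fun x => S x + T x).
Proof.
move=> [bS saS] [bT saT]; split; first exact: bounded_operatorD.
by move=> x y; rewrite innerDl innerDr saS saT.
Qed.

Theorem proposition2p3 (R : realType) (A : starAlgType (complex R)) (H : hilbertType R)
    (pi : A -> H -> H) (H0 : set H) (D : H -> H)
    (V : set H) (nu : H -> H) (J : H -> H) (eps eps' : bool)
    (hD : twisted_real_spectral_triple pi H0 V nu J D eps eps')
    (alpha : H -> H) (halpha : one_form pi H0 D alpha)
    (hsa : selfadjoint_fluctuation H0 nu J eps' alpha) :
  let Dalpha := fluctuated nu J D eps' alpha in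
  [/\ twisted_real_spectral_triple pi H0 V nu J Dalpha eps eps',
      forall (gamma : H -> H) (eps'' : bool),
        even_with_grading pi H0 nu J D gamma eps'' ->
        even_with_grading pi H0 nu J Dalpha gamma eps'' &
      forall beta : H -> H,
        one_form pi H0 Dalpha beta ->
        selfadjoint_fluctuation H0 nu J eps' beta ->
        exists delta : H -> H,
          [/\ one_form pi H0 D delta,
              selfadjoint_fluctuation H0 nu J eps' delta &
              forall x, H0 x ->
                fluctuated nu J Dalpha eps' beta x = fluctuated nu J D eps' delta x]].
Proof.
have [[_ [_ _ _ _ [nuhat [nuhat_auto nuhatE]]]] _ _ _ _] := hD.
have [balpha [s alphaE]] := halpha.
split.
- exact: (fluctuated_triple hD nuhat_auto nuhatE alphaE balpha hsa).
- move=> gamma eps'' ev.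
  exact: (fluctuated_even hD nuhatE alphaE balpha ev).
move=> beta [bbeta [r betaE]] hsb.
have [t ht] := fluctuated_form hD nuhat_auto nuhatE alphaE balpha r.
have betaD x : H0 x -> beta x = formal_form pi D t x.
  by move=> H0x; rewrite betaE // ht.
have alphaH0 x : H0 x -> H0 (alpha x).
  by move=> H0x; rewrite alphaE //; exact: (formal_form_dom hD).
have betaH0 x : H0 x -> H0 (beta x).
  by move=> H0x; rewrite betaD //; exact: (formal_form_dom hD).
have flD := fluctuationD hD alphaH0 betaH0.
exists (fun x => alpha x + beta x); split.
- split; first exact: bounded_operatorD.
  (* [t] represents [beta] as a one-form for D instead of D_alpha, so the lists can be joined. *)
  exists (s ++ t) => x H0x.
  by rewrite big_cat alphaE // betaD.
- have [S [saS SE]] := hsa; have [T [saT TE]] := hsb.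
  exists (fun x => S x + T x); split; first exact: bounded_selfadjointD.
  by move=> x H0x; rewrite SE // TE // flD.
- by move=> x H0x; rewrite /fluctuated flD //; exact/esym/addrA.
Qed.
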